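(* Let $\underline{S}$ be the set of rough naturals formed according to the IPC schema (IPC counts of finite strings), with the relation $\trianglelefteq$ and predicate $\zeta$ defined in the context. Then $\trianglelefteq$ is a quasi order (a reflexive and transitive relation) on $\underline{S}$, and $\trianglelefteq\,\cap\,\zeta^{2}\,=\,\leq$; that is, the restriction of $\trianglelefteq$ to the set $\{x\in\underline{S}:\zeta(x)\}$ coincides with the usual order $\leq$ on integers, where $1_12_1\cdots k_1$ is identified with $k$.
   Context: Consider finite strings of objects $s_1 s_2\cdots s_n$ ($n\ge 0$) for which it is known, for each $k<n$, whether $s_k\approx s_{k+1}$ ($s_k$ and $s_{k+1}$ are indiscernible) or not (they are discernible). The IPC (indiscernible-predecessor based) count of such a string is the sequence of symbols $f(s_1),\dots,f(s_n)$, where a symbol has the form $r_j$ ($r,j$ positive integers), given by: $f(s_1)=1_1$; if $f(s_k)=r_j$ and $s_k\approx s_{k+1}$ then $f(s_{k+1})=1_{j+1}$; if $f(s_k)=r_j$ and $s_k\not\approx s_{k+1}$ then $f(s_{k+1})=(r+1)_j$. The set of all IPC counts (including the count $0$ of the empty string) is $\underline{S}$; it is the underlying set of what the paper calls a full ordered rough IPC algebra. For $x\in\underline{S}$, $\nu(x)$ is the length of the string whose count is $x$. The predicate $\zeta(x)$ holds iff $x=1_1 2_1\cdots k_1$ for some $k$ (all consecutive members discernible); such a count is abbreviated by $k$. The relation $\trianglelefteq$ is defined by: $x\trianglelefteq y$ iff $\nu(x)\leq\nu(y)$, where $\leq$ is the usual total order on integers. The set $\{(x,y):\zeta(x),\zeta(y)\}$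 is denoted $\zeta^2$. *)

(* Defs.v *)
From mathcomp Require Import all_boot.
From mathcomp Require Import boolp classical_sets.

Set Implicit Arguments.
Unset Strict Implicit.
Unset Printing Implicit Defensive.

Local Open Scope classical_set_scope.

(* Only the comparisons of consecutive objects are ever used, so no axiom is
   imposed on indiscernibility; it is boolean because it is known. *)
Record object_string := ObjectString {
  object : Type;
  indiscernible : rel object;
  objects : seq object
}.

(* (r, j) stands for r_j; both components are positive in every count, since
   counting starts at (1, 1) and never decreases a component below 1. *)
Definition symbol : Type := (nat * nat)%type.

Definition next_symbol (f : symbol) (indisc : bool) : symbol :=
  if indisc then (1, f.2.+1) else (f.1.+1, f.2).

(* The symbols of the objects of s, which follow an object a of symbol f. *)
Fixpoint ipc_after (T : Type) (e : rel T) (a : T) (f : symbol) (s : seq T) :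
    seq symbol :=
  if s is b :: s' then
    let g := next_symbol f (e a b) in g :: ipc_after e b g s'
  else [::].

Definition ipc_count (s : object_string) : seq symbol :=
  if objects s is a :: s' then
    (1, 1) :: ipc_after (@indiscernible s) a (1, 1) s'
  else [::].

(* The set S of all IPC counts; it is used below as a type of its elements. *)
Definition ipc_counts : set (seq symbol) :=
  [set x | exists s : object_string, ipc_count s = x].

(* The length of a chosen string with count x; all strings with the same count
   have the same length, so that the choice is immaterial. *)
Definition nu (x : ipc_counts) : nat :=
  size (objects (projT1 (cid (set_valP x)))).

Definition ipc_le : rel ipc_counts := fun x y => nu x <= nu y.

(* 1_1 2_1 ... k_1; for k = 0 it is the count of the empty string. *)
Definition numeral_count (k : nat) : seq symbol := [seq (i, 1) | i <- iota 1 k].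

Definition zeta : set ipc_counts :=
  [set x | exists k : nat, \val x = numeral_count k].

Lemma numeral_count_in (k : nat) : numeral_count k \in ipc_counts.
Proof.
apply/mem_set; exists (@ObjectString nat (fun _ _ => false) (iota 0 k)).
have shift r a b n : ipc_after (fun _ _ : nat => false) a (r, 1) (iota b n) =
    [seq (i, 1) | i <- iota r.+1 n].
  by elim: n r a b => //= n IHn r a b; rewrite IHn.
by case: k => //= k; rewrite /ipc_count /= shift.
Qed.

(* The identification of k with 1_1 2_1 ... k_1. *)
Definition numeral (k : nat) : ipc_counts := SigSub (numeral_count_in k).

Lemma numeral_inj : injective numeral.
Proof.
move=> m n /(congr1 (fun x : ipc_counts => size (\val x))).
by rewrite /= !size_map !size_iota.
Qed.

(* Main.v *)
Require Import Defs.
From mathcomp Require Import all_boot.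
From mathcomp Require Import boolp classical_sets.

(** Counting assigns exactly one symbol to each object, so every string with
    count [x] has as many objects as [x] has symbols ([nuE]). Hence [ipc_le]
    compares the natural numbers [size (\val x)]: it is the pullback of a total
    order along a function, which is a quasi order. It is not antisymmetric on
    all counts, but a count in [zeta] is determined by its length: it is
    [numeral k] with [k] its length. On these counts the length inverts
    [numeral], and the pulled-back order is the order of the integers. *)

Local Open Scope classical_set_scope.

Lemma size_ipc_after (T : Type) (e : rel T) (a : T) (f : symbol) (s : seq T) :
  size (ipc_after e a f s) = size s.
Proof. by elim: s a f => //= b s IHs a f; rewrite IHs. Qed.

Lemma size_ipc_count (s : object_string) : size (ipc_count s) = size (objects s).
Proof. by case: s => T e [|a s] //=; rewrite /ipc_count /= size_ipc_after. Qed.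

(** Frees [nu] from the choice of a string: the length can be read off the
    count itself. *)
Lemma nuE (x : ipc_counts) : nu x = size (\val x).
Proof. by rewrite /nu; case: cid => s /= <-; rewrite size_ipc_count. Qed.

Lemma nu_numeral (k : nat) : nu (numeral k) = k.
Proof. by rewrite nuE size_map size_iota. Qed.

Lemma ipc_le_numeral (m n : nat) : ipc_le (numeral m) (numeral n) = (m <= n).
Proof. by rewrite /ipc_le !nu_numeral. Qed.

Lemma zetaE : zeta = range numeral.
Proof.
apply/seteqP; split=> [x [k xk]|_ [k _ <-]]; last by exists k.
by exists k => //; apply: val_inj.
Qed.

Theorem proposition7 :
  (reflexive ipc_le /\ transitive ipc_le) /\
  [set p : ipc_counts * ipc_counts | ipc_le p.1 p.2] `&` (zeta `*` zeta) =
  [set (numeral q.1, numeral q.2) | q in [set q : nat * nat | q.1 <= q.2]].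
Proof.
split; first by split=> [x|y x z]; [exact: leqnn | exact: leq_trans].
rewrite zetaE; apply/seteqP; split=> [[x y] /=|_ [[m n] /= le_mn <-]].
  move=> [le_xy [[m _ def_x] [n _ def_y]]].
  by exists (m, n); rewrite /= ?def_x ?def_y // -ipc_le_numeral def_x def_y.
split; first by rewrite /= ipc_le_numeral.
by split; [exists m | exists n].
Qed.
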